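(* Assume $\gamma_{\min}^A<1<\gamma_{\max}^A<2$, $1\in I_R$ and $1\in I_X$, and suppose $C$ is square ($m=p$) and nonsingular. Then for any eigenvalue $\lambda$ of $\mathcal{P}^{-1}\mathcal{A}$ with $\lambda\notin I_A$: if $E=0$, there exist $\gamma_A\in I_A$, $\gamma_R\in I_R$, $\gamma_K\in I_K$ such that $\pi(\lambda;\gamma_A,\gamma_R,\gamma_K)=0$; if $E\neq0$, there exist $\gamma_A\in I_A$, $\gamma_R\in I_R$, $\gamma_K\in I_K$, $\gamma_E\in I_E$, $\gamma_X\in I_X$ with $\gamma_X=\gamma_K+\gamma_E$ such that $\pi_E(\lambda;\gamma_A,\gamma_R,\gamma_K,\gamma_E)=0$.
   Context: Let $n\ge m\ge p$ be positive integers, $A\in\mathbb{R}^{n\times n}$ symmetric positive definite (SPD), $B\in\mathbb{R}^{m\times n}$ and $C\in\mathbb{R}^{p\times m}$ of full row rank, $E\in\mathbb{R}^{p\times p}$ symmetric positive semidefinite, and $$\mathcal{A}=\begin{bmatrix}A&B^\top&0\\ B&0&C^\top\\ 0&C&E\end{bmatrix}.$$ Let $\widehat A$ be an SPD approximation of $A$; $\widetilde S=B\widehat A^{-1}B^\top$ and $\widehat S$ an SPD approximation of $\widetilde S$; $\widetilde X=E+C\widehat S^{-1}C^\top$ and $\widehat X$ an SPD approximation of $\widetilde X$ (each hatted matrix is an SPD matrix of the appropriate size). The preconditioner is $\mathcal{P}=\mathcal{P}_L\mathcal{P}_D^{-1}\mathcal{P}_L^\top$ with $$\mathcal{P}_L=\begin{bmatrix}\widehat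 A&0&0\\ B&-\widehat S&0\\ 0&C&\widehat X\end{bmatrix},\qquad \mathcal{P}_D=\begin{bmatrix}\widehat A&0&0\\ 0&\widehat S&0\\ 0&0&\widehat X\end{bmatrix}.$$ Put $K=\widehat X^{-1/2}C\widehat S^{-1/2}$. Define the intervals $I_\ast=[\gamma_{\min}^\ast,\gamma_{\max}^\ast]$ for $\ast\in\{A,R,X,E,K\}$, whose endpoints are the smallest and largest eigenvalues of, respectively, $\widehat A^{-1}A$, $\widehat S^{-1}\widetilde S$, $\widehat X^{-1}\widetilde X$, $\widehat X^{-1}E$, $KK^\top$. Define $p(\lambda;\gamma_A,\gamma_R)=\lambda^2-\lambda(\gamma_A\gamma_R+\gamma_A-2\gamma_R)-\gamma_R$, $$\pi(\lambda;\gamma_A,\gamma_R,\gamma_K)=(1+\lambda)^2(\gamma_A-\lambda)\gamma_K+p(\lambda;\gamma_A,\gamma_R)\,\lambda\,(1+\gamma_K),$$ $$\pi_E(\lambda;\gamma_A,\gamma_R,\gamma_K,\gamma_E)=\pi(\lambda;\gamma_A,\gamma_R,\gamma_K)-\gamma_E\,p(\lambda;\gamma_A,\gamma_R).$$ *)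

(* Defs.v *)
From mathcomp Require Import all_boot all_order all_algebra.
From mathcomp Require Import boolp classical_sets reals.
Set Implicit Arguments.
Unset Strict Implicit.
Unset Printing Implicit Defensive.
Import Order.TTheory GRing.Theory Num.Theory.
Local Open Scope ring_scope.

Definition spd (R : realType) n (M : 'M[R]_n) : Prop :=
  M \is symmetricmx /\
  forall x : 'cV[R]_n, x != 0 -> 0 < (x^T *m M *m x) 0 0.

Definition spsd (R : realType) n (M : 'M[R]_n) : Prop :=
  M \is symmetricmx /\
  forall x : 'cV[R]_n, 0 <= (x^T *m M *m x) 0 0.

(* The principal square root, i.e. the unique SPD square root of an SPD matrix;
   the default value 0 is only reached when M is not SPD. *)
Definition sqrtmx (R : realType) n (M : 'M[R]_n) : 'M[R]_n :=
  xget 0 [set N : 'M[R]_n | spd N /\ N *m N = M]%classic.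

(* Smallest and largest real eigenvalue, with default value 0 when the matrix
   has no real eigenvalue.  They are only applied to matrices that are similar
   to real symmetric matrices, whose whole spectrum is real.  [eigenvalue] is
   defined with row vectors; left and right eigenvalues coincide. *)
Definition eigmin (R : realType) n (M : 'M[R]_n) : R :=
  xget 0 [set a : R | eigenvalue M a /\
                      forall b : R, eigenvalue M b -> a <= b]%classic.

Definition eigmax (R : realType) n (M : 'M[R]_n) : R :=
  xget 0 [set a : R | eigenvalue M a /\
                      forall b : R, eigenvalue M b -> b <= a]%classic.

Definition eigitv (R : realType) n (M : 'M[R]_n) : interval R :=
  `[eigmin M, eigmax M].

Section Saddle.
Variables (R : realType) (n m p : nat).
Implicit Types (A Ah : 'M[R]_n) (B : 'M[R]_(m, n)) (C : 'M[R]_(p, m)).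
Implicit Types (Sh : 'M[R]_m) (E Xh : 'M[R]_p).

Definition saddle A B C E : 'M[R]_(n + m + p) :=
  block_mx (block_mx A B^T B 0) (col_mx 0 C^T)
           (row_mx 0 C)         E.

Definition schurS Ah B : 'M[R]_m := B *m invmx Ah *m B^T.

Definition schurX Sh C E : 'M[R]_p := E + C *m invmx Sh *m C^T.

Definition precL Ah B Sh C Xh : 'M[R]_(n + m + p) :=
  block_mx (block_mx Ah 0 B (- Sh)) 0
           (row_mx 0 C)             Xh.

Definition precD Ah Sh Xh : 'M[R]_(n + m + p) :=
  block_mx (block_mx Ah 0 0 Sh) 0
           0                    Xh.

(* For SPD Ah, Sh, Xh this matrix is SPD, so the eigenvalues of
   invmx (prec _ _ _ _ _) *m saddle _ _ _ _ are all real. *)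
Definition prec Ah B Sh C Xh : 'M[R]_(n + m + p) :=
  precL Ah B Sh C Xh *m invmx (precD Ah Sh Xh) *m (precL Ah B Sh C Xh)^T.

Definition Kmx Sh C Xh : 'M[R]_(p, m) :=
  sqrtmx (invmx Xh) *m C *m sqrtmx (invmx Sh).

Definition itvA Ah A : interval R := eigitv (invmx Ah *m A).
Definition itvR Ah B Sh : interval R := eigitv (invmx Sh *m schurS Ah B).
Definition itvX Sh C E Xh : interval R := eigitv (invmx Xh *m schurX Sh C E).
Definition itvE E Xh : interval R := eigitv (invmx Xh *m E).
Definition itvK Sh C Xh : interval R :=
  eigitv (Kmx Sh C Xh *m (Kmx Sh C Xh)^T).

End Saddle.

Definition p_pol (R : realType) (l gA gR : R) : R :=
  l ^+ 2 - l * (gA * gR + gA - 2 * gR) - gR.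

Definition pi_pol (R : realType) (l gA gR gK : R) : R :=
  (1 + l) ^+ 2 * (gA - l) * gK + p_pol l gA gR * l * (1 + gK).

Definition piE_pol (R : realType) (l gA gR gK gE : R) : R :=
  pi_pol l gA gR gK - gE * p_pol l gA gR.

(* Main.v *)
Require Import Defs.
From mathcomp Require Import all_boot all_order all_algebra.
From mathcomp Require Import boolp classical_sets reals.
From mathcomp Require Import complex polyrcf ring lra.
Set Implicit Arguments.
Unset Strict Implicit.
Unset Printing Implicit Defensive.
Import Order.TTheory GRing.Theory Num.Theory.
Local Open Scope ring_scope.

(* With [w := Sh^-1 C^T z], eliminating [x] from the eigenvector equations
   leaves [My y = (1 + lam) Sh w] and [Nz z = (1 + lam) C y] for symmetric [My]
   and [Nz].  Relative to [Sh], the Rayleigh quotient [mu] of [My] at any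
   [y <> 0] equals [- p_pol lam gA gR / (gA - lam)] for some [gA], [gR] in their
   intervals; relative to [Xh], that of [Nz] at any [z <> 0] is
   [nu = lam (1 + gK) - gE], and
     piE_pol = (gA - lam) ((1 + lam)^2 gK - mu nu).
   At an eigenvector [(y, z)] with [y, z <> 0], Cauchy-Schwarz makes the second
   factor nonnegative.  The admissible [(gA, gR, gK, gE)] form a convex set, so
   by the intermediate value theorem it suffices to find one where [piE_pol] has
   the opposite sign:
   - if [lam] exceeds the interval of [gA], take [gA = gR = 1], [gK + gE = 1];
   - if [lam] lies below it and [0 <= lam], then [My] is positive definite, and
     Cauchy-Schwarz for [My] shows that the parameters of [(w, z)] work;
   - if [lam < 0], then [- Nz] is positive definite, and those of [(y, z')] with
     [Sh^-1 C^T z' = y] work.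
   Only for [lam = -1] can [z] vanish; then [p_pol] itself is [0] at [y]. *)

(** * Spectrum and roots of real symmetric matrices *)

Lemma symmetricmxE (R : fieldType) n (M : 'M[R]_n) :
  (M \is symmetricmx) = (M^T == M).
Proof. by rewrite is_hermitianmxE expr0 scale1r map_mx_id // eq_sym. Qed.

(** Each new node is corrected by a multiple of the product vanishing at the old ones. This realizes
    a function of a symmetric matrix as a polynomial in that matrix. *)
Lemma poly_interpolation (F : fieldType) (f : F -> F) (s : seq F) :
  exists q : {poly F}, {in s, forall a, q.[a] = f a}.
Proof.
elim: s => [|a s [q qP]]; first by exists 0.
have [a_in|a_notin] := boolP (a \in s).
  by exists q => b; rewrite inE => /predU1P[->|]; exact: qP.
pose r := \prod_(z <- s) ('X - z%:P).
have ra : r.[a] != 0 by rewrite -/(root r a) root_prod_XsubC.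
exists (q + ((f a - q.[a]) / r.[a])%:P * r) => b; rewrite inE !hornerE.
case/predU1P => [->|b_in]; first by rewrite divfK // addrC subrK.
have /rootP -> : root r b by rewrite root_prod_XsubC.
by rewrite mulr0 addr0 qP.
Qed.

Section SymmetricReal.
Variables (R : rcfType) (n : nat) (T : 'M[R]_n.+1).
Hypothesis T_sym : T^T = T.

Let toC := real_complex R.
Let TC : 'M[R[i]]_n.+1 := map_mx toC T.

(** Over [R[i]] the matrix is Hermitian, so it is diagonalizable with a real diagonal. The
    conjugating [P] stays complex, which suffices to verify polynomial identities in [T]. *)
Lemma sym_spectrum :
  exists (d : 'rV[R]_n.+1) (P : 'M[R[i]]_n.+1),
    [/\ P \in unitmx, TC = invmx P *m diag_mx (map_mx toC d) *m P &
        forall j, eigenvalue T (d 0 j)].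
Proof.
have TC_herm : TC \is hermsymmx.
  apply: realsym_hermsym; first by rewrite symmetricmxE /TC map_trmx T_sym.
  by apply/mxOverP => i j; rewrite mxE complex_real.
have TC_eq := orthomx_spectralP (hermitian_normalmx TC_herm).
have /mxOverP d_real := hermitian_spectral_diag_real TC_herm.
have P_unit := spectral_unit TC.
move: TC_eq d_real P_unit => /=.
set P := spectralmx TC; set dC := spectral_diag TC => TC_eq d_real P_unit.
have dE : map_mx toC (map_mx (@complex.Re R) dC) = dC.
  by apply/matrixP => i j; rewrite !mxE; exact: RRe_real (d_real _ _).
exists (map_mx (@complex.Re R) dC), P; split; rewrite ?dE //.
move=> j; rewrite eigenvalue_root_char -(fmorph_root toC) map_char_poly.
rewrite -eigenvalue_root_char; apply/eigenvalueP; exists (row j P); last first.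
  apply: contraTneq P_unit => Pj0; rewrite unitmxE (expand_det_row _ j).
  rewrite big1 ?unitr0 // => k _; move/rowP: Pj0 => /(_ k).
  by rewrite !mxE => ->; rewrite mul0r.
rewrite -/TC TC_eq -row_mul !mulmxA mulmxV // mul1mx.
apply/rowP => k; rewrite !mxE (bigD1 j) //= big1 ?addr0.
  by rewrite !mxE eqxx mulr1n RRe_real.
by move=> i ij; rewrite !mxE eq_sym (negPf ij) mulr0n mul0r.
Qed.

Lemma sym_eigenvalue_exists : exists a, eigenvalue T a.
Proof. by have [d [_ [_ _ dP]]] := sym_spectrum; exists (d 0 0). Qed.

(* The root is a polynomial in [T], hence real and symmetric.  A fourth root is
   taken so that its square is a positive semidefinite square root of [T]. *)
Lemma sym_root4_exists : (forall a, eigenvalue T a -> 0 <= a) ->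
  exists2 N : 'M[R]_n.+1, N^T = N & N *m N *m (N *m N) = T.
Proof.
move=> T_ge0; have [d [P [P_unit TC_eq dP]]] := sym_spectrum.
pose root4 (a : R) := Num.sqrt (Num.sqrt a).
have [q qP] := poly_interpolation root4 [seq d 0 j | j : 'I_n.+1].
exists (horner_mx T q).
  elim/poly_ind: q {qP} => [|q c IH]; first by rewrite rmorph0 trmx0.
  rewrite rmorphD rmorphM /= horner_mx_X horner_mx_C linearD /= trmx_mul.
  rewrite IH T_sym.
  by rewrite tr_scalar_mx; congr (_ + _); apply: comm_mx_horner.
have -> (N := horner_mx T q) :
    N *m N *m (N *m N) = horner_mx T (q * q * (q * q)) by rewrite !rmorphM.
apply/eqP; rewrite -subr_eq0 -[X in _ - X]horner_mx_X.
rewrite -rmorphB /= -(map_mx_eq0 toC).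
rewrite map_horner_mx -/TC TC_eq horner_mx_uconjC // horner_mx_diag.
suff -> : map_mx (horner (map_poly toC (q * q * (q * q) - 'X)))
                 (map_mx toC d) = 0.
  by rewrite linear0 mulmx0 mul0mx.
apply/matrixP => i j; rewrite !mxE horner_map /= ord1.
have root4K : root4 (d 0 j) ^+ 4 = d 0 j.
  by rewrite (exprM _ 2 2) !sqr_sqrtr ?sqrtr_ge0 ?T_ge0.
rewrite hornerD hornerN hornerX !hornerM qP; last first.
  by apply/mapP; exists j; rewrite ?mem_enum.
by rewrite -!expr2 -exprM root4K subrr.
Qed.

End SymmetricReal.

(** * Bilinear forms and positive definite matrices *)

Definition bform (R : realType) n (G : 'M[R]_n) (u v : 'cV[R]_n) : R :=
  (u^T *m G *m v) 0 0.

Section BilinearForms.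
Variables (R : realType) (n : nat).
Implicit Types (G H : 'M[R]_n) (u v w : 'cV[R]_n) (a b : R).

Lemma bformDl G u v w : bform G (u + v) w = bform G u w + bform G v w.
Proof. by rewrite /bform linearD !mulmxDl mxE. Qed.

Lemma bformDr G u v w : bform G w (u + v) = bform G w u + bform G w v.
Proof. by rewrite /bform mulmxDr mxE. Qed.

Lemma bformZl G a u v : bform G (a *: u) v = a * bform G u v.
Proof. by rewrite /bform linearZ -!scalemxAl mxE. Qed.

Lemma bformZr G a u v : bform G u (a *: v) = a * bform G u v.
Proof. by rewrite /bform -scalemxAr mxE. Qed.

Lemma bform0r G u : bform G u 0 = 0.
Proof. by rewrite /bform mulmx0 mxE. Qed.

Lemma bform_addmx G H u v : bform (G + H) u v = bform G u v + bform H u v.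
Proof. by rewrite /bform mulmxDr mulmxDl mxE. Qed.

Lemma bform_scalemx a G u v : bform (a *: G) u v = a * bform G u v.
Proof. by rewrite /bform -scalemxAr -scalemxAl mxE. Qed.

Lemma bform_oppmx G u v : bform (- G) u v = - bform G u v.
Proof. by rewrite -scaleN1r bform_scalemx mulN1r. Qed.

Lemma bform_tr G u v : bform G^T u v = bform G v u.
Proof.
by rewrite /bform -[v^T *m G *m u]trmxK [in RHS]mxE !trmx_mul trmxK mulmxA.
Qed.

Lemma bformC G u v : G^T = G -> bform G u v = bform G v u.
Proof. by move=> G_sym; rewrite -{1}G_sym bform_tr. Qed.

Lemma bform_sandwich m (G : 'M[R]_m) (N : 'M[R]_(m, n)) u v :
  bform (N^T *m G *m N) u v = bform G (N *m u) (N *m v).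
Proof. by rewrite /bform trmx_mul !mulmxA. Qed.

Lemma bform_eq G H u v w : G *m v = H *m w -> bform G u v = bform H u w.
Proof. by move=> e; rewrite /bform -!mulmxA e. Qed.

Lemma bform1_ge0 u : 0 <= bform 1%:M u u.
Proof.
by rewrite /bform mulmx1 mxE sumr_ge0 // => i _; rewrite mxE -expr2 sqr_ge0.
Qed.

Lemma bform1_gt0 u : u != 0 -> 0 < bform 1%:M u u.
Proof.
move=> u0; rewrite lt_neqAle bform1_ge0 andbT eq_sym; apply: contraNneq u0.
rewrite /bform mulmx1 mxE => /eqP; rewrite psumr_eq0; last first.
  by move=> i _; rewrite mxE -expr2 sqr_ge0.
move=> /allP z; apply/eqP/matrixP => i j; rewrite ord1 [RHS]mxE.
have := z i; rewrite mem_index_enum => /(_ isT).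
by rewrite mxE -expr2 sqrf_eq0 => /eqP.
Qed.

(** The form is nonnegative on a suitable combination of [u] and [v]. As [G] may be degenerate, the
    case [bform G v v = 0] gets its own coefficients. *)
Lemma bform_cauchy_schwarz G u v : G^T = G -> (forall x, 0 <= bform G x x) ->
  bform G u v ^+ 2 <= bform G u u * bform G v v.
Proof.
move=> G_sym G_ge0.
have expand a b : 0 <= a ^+ 2 * bform G u u + 2 * a * b * bform G u v
                       + b ^+ 2 * bform G v v.
  have := G_ge0 (a *: u + b *: v).
  rewrite !bformDl !bformDr !bformZl !bformZr (bformC v u) //.
  by congr (_ <= _); ring.
have vv := G_ge0 v.
have [v0|v_neq0] := eqVneq (bform G v v) 0; last first.
  have v_gt0 : 0 < bform G v v by rewrite lt_neqAle eq_sym v_neq0.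
  rewrite -subr_ge0 -(pmulr_rge0 _ v_gt0).
  have := expand (bform G v v) (- bform G u v).
  by congr (_ <= _); ring.
rewrite v0 mulr0 real_leNgt ?realE ?sqr_ge0 ?lexx //; apply/negP => uv_gt0.
(* The expansion is now linear in [b]; these coefficients turn it into [- s^2 (12 t + 4)], negative
   unless [s = 0]. *)
have := expand (2 * bform G u v) (- (bform G u u * 4%:R + 1)); rewrite v0.
set s := bform G u v in uv_gt0 *; set t := bform G u u.
have -> : (2 * s) ^+ 2 * t + 2 * (2 * s) * (- (t * 4%:R + 1)) * s
          + (- (t * 4%:R + 1)) ^+ 2 * 0 = - (s ^+ 2 * (12%:R * t + 4%:R)).
  by ring.
by rewrite oppr_ge0 leNgt pmulr_rgt0 // ltr_wpDl // mulr_ge0 // G_ge0.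
Qed.

Lemma spd_sym G : spd G -> G^T = G.
Proof. by case; rewrite symmetricmxE => /eqP. Qed.

Lemma spd_gt0 G u : spd G -> u != 0 -> 0 < bform G u u.
Proof. by case=> _; exact. Qed.

Lemma spd_ge0 G u : spd G -> 0 <= bform G u u.
Proof.
have [->|u0] := eqVneq u 0; first by rewrite bform0r.
by move=> G_spd; rewrite ltW ?spd_gt0.
Qed.

Lemma spsd_sym G : spsd G -> G^T = G.
Proof. by case; rewrite symmetricmxE => /eqP. Qed.

Lemma spsd_ge0 G u : spsd G -> 0 <= bform G u u.
Proof. by case=> _; exact. Qed.

Lemma spdP G : G^T = G -> (forall u, u != 0 -> 0 < bform G u u) -> spd G.
Proof. by move=> G_sym G_pos; split; rewrite ?symmetricmxE ?G_sym. Qed.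

Lemma spd_unit G : spd G -> G \in unitmx.
Proof.
move=> G_spd; rewrite -row_free_unit -kermx_eq0; apply/rowV0P => v.
move=> /sub_kermxP vG0; apply/eqP/negPn/negP => v0.
have := @spd_gt0 _ v^T G_spd; rewrite trmx_eq0 => /(_ v0).
by rewrite /bform trmxK vG0 mul0mx mxE ltxx.
Qed.

Lemma invmx_sym G : G^T = G -> (invmx G)^T = invmx G.
Proof. by move=> G_sym; rewrite trmx_inv G_sym. Qed.

Lemma bform_invmx G u v : G \in unitmx -> G^T = G ->
  bform (invmx G) (G *m u) (G *m v) = bform G u v.
Proof.
by move=> Gu G_sym; rewrite -bform_sandwich G_sym mulmxV // mul1mx.
Qed.

Lemma spd_invmx G : spd G -> spd (invmx G).
Proof.
move=> G_spd; have Gu := spd_unit G_spd; have G_sym := spd_sym G_spd.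
apply: spdP => [|u u0]; first exact: invmx_sym.
rewrite -[u](mulKVmx Gu) bform_invmx // spd_gt0 //.
by apply: contra_neq u0 => e; rewrite -[u](mulKVmx Gu) e mulmx0.
Qed.

(** [eigenvalue] speaks of row vectors: transposing [v H^-1 G = a v] shows that the column
    [H^-1 v^T] solves the symmetric pencil. *)
Lemma pencil_eigenvector H G a : H \in unitmx -> H^T = H -> G^T = G ->
  eigenvalue (invmx H *m G) a ->
  exists2 u : 'cV[R]_n, u != 0 & G *m u = a *: (H *m u).
Proof.
move=> Hu H_sym G_sym /eigenvalueP[v vE v0]; exists (invmx H *m v^T).
  apply: contra_neq v0 => e; apply: trmx_inj.
  by rewrite trmx0 -[v^T](mulKVmx Hu) e mulmx0.
rewrite mulKVmx //; apply: trmx_inj; rewrite linearZ /= trmxK -vE.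
by rewrite !trmx_mul trmxK G_sym invmx_sym // mulmxA.
Qed.

End BilinearForms.

(** * Rayleigh quotients of definite pencils *)

Section RayleighQuotients.
Variables (R : realType) (n : nat).
Implicit Types (G H : 'M[R]_n.+1).

(** The square of a symmetric fourth root [L] is semidefinite, and invertibility of [L] makes it
    definite. *)
Lemma spd_sqrt_exists H : spd H -> exists2 N, spd N & N *m N = H.
Proof.
move=> H_spd; have H_sym := spd_sym H_spd.
have [|L L_sym LLLL] := sym_root4_exists H_sym.
  move=> a /eigenvalueP[v vH v0].
  have := @spd_ge0 _ _ H v^T H_spd; rewrite /bform trmxK vH -scalemxAl mxE.
  have := @bform1_gt0 _ _ v^T; rewrite trmx_eq0 /bform trmxK mulmx1.
  by move=> /(_ v0) vv; rewrite pmulr_lge0.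
exists (L *m L) => //; have Lu : L \in unitmx.
  by have := spd_unit H_spd; rewrite -LLLL !unitmx_mul -!andbA => /andP[].
apply: spdP => [|u u0]; first by rewrite trmx_mul L_sym.
rewrite -[X in X *m _]L_sym -[X in X *m _]mulmx1 bform_sandwich bform1_gt0 //.
by apply: contra_neq u0 => e; rewrite -[u](mulKmx Lu) e mulmx0.
Qed.

Lemma sqrtmxP H : spd H -> spd (sqrtmx H) /\ sqrtmx H *m sqrtmx H = H.
Proof.
move=> /spd_sqrt_exists[N N_spd NN]; rewrite /sqrtmx.
by case: xgetP => [M _ []//|/(_ N)[]].
Qed.

(** The equality of predicates allows rewriting inside [eigmin] and [eigmax], which see only the
    predicate. *)
Lemma eigenvalue_similar (P G H : 'M[R]_n.+1) : P \in unitmx ->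
  P *m G = H *m P -> eigenvalue G = eigenvalue H.
Proof.
have imp (Q G' H' : 'M[R]_n.+1) a : Q \in unitmx -> Q *m G' = H' *m Q ->
    eigenvalue H' a -> eigenvalue G' a.
  move=> Qu e /eigenvalueP[v vH v0]; apply/eigenvalueP; exists (v *m Q).
    by rewrite -mulmxA e mulmxA vH scalemxAl.
  by apply: contra_neq v0 => vQ; rewrite -[v](mulmxK Qu) vQ mul0mx.
move=> Pu e; apply/funext => a; apply/idP/idP; last exact: imp e.
apply: (imp (invmx P)); rewrite ?unitmx_inv //.
by apply: (canLR (mulKmx Pu)); rewrite mulmxA e mulmxK.
Qed.

Lemma seq_min (s : seq R) a : a \in s ->
  exists2 b, b \in s & {in s, forall c, b <= c}.
Proof.
elim: s a => [//|x [_ a _|y s IH a _]].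
  by exists x => [|c]; rewrite inE // => /eqP->; exact: lexx.
have [b b_in b_min] := IH y (mem_head y s).
have [xb|bx] := leP x b.
  exists x => [|c]; first exact: mem_head.
  by rewrite inE => /predU1P[->//|/b_min]; exact: le_trans.
exists b => [|c]; first by rewrite inE b_in orbT.
by rewrite inE => /predU1P[->|/b_min//]; exact: ltW.
Qed.

Lemma eigenvalues_seq G :
  exists s : seq R, forall a, eigenvalue G a = (a \in s).
Proof.
have cG : char_poly G != 0 by rewrite monic_neq0 ?char_poly_monic.
exists (rootsR (char_poly G)) => a; rewrite eigenvalue_root_char.
by rewrite -(roots_on_rootsR cG) inE.
Qed.

(** The spectrum is a finite set of roots, so one eigenvalue ensures a least one, and the default of
    [xget] is not reached. *)
Lemma eigminP G a : eigenvalue G a ->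
  eigenvalue G (eigmin G) /\ forall b, eigenvalue G b -> eigmin G <= b.
Proof.
have [s sP] := eigenvalues_seq G; rewrite sP => /seq_min[b b_in b_min].
rewrite /eigmin; case: xgetP => // /(_ b)[]; split; first by rewrite sP.
by move=> c; rewrite sP; exact: b_min.
Qed.

Lemma eigmaxP G a : eigenvalue G a ->
  eigenvalue G (eigmax G) /\ forall b, eigenvalue G b -> b <= eigmax G.
Proof.
have [s sP] := eigenvalues_seq G; rewrite sP => /(map_f -%R)/seq_min.
move=> [_ /mapP[b b_in ->] b_max].
rewrite /eigmax; case: xgetP => // /(_ b)[]; split; first by rewrite sP.
by move=> c; rewrite sP => /(map_f -%R)/b_max; rewrite lerN2.
Qed.

(** With [N] the square root of [H], the matrix [T = N^-1 G N^-1] is congruent to [G] and, by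
    conjugation with [N], similar to [H^-1 G]. *)
Lemma pencil_similar_sym H G : spd H -> G^T = G ->
  exists N T : 'M[R]_n.+1, [/\ N^T = N, T^T = T, G = N *m T *m N &
                              eigenvalue (invmx H *m G) = eigenvalue T].
Proof.
move=> H_spd G_sym; have [N N_spd NN] := spd_sqrt_exists H_spd.
have Nu := spd_unit N_spd; have N_sym := spd_sym N_spd.
have iN_sym := invmx_sym N_sym.
exists N, (invmx N *m G *m invmx N); split=> //.
- by rewrite !trmx_mul iN_sym G_sym mulmxA.
- by rewrite !mulmxA mulmxV // mul1mx mulmxKV.
apply: (eigenvalue_similar Nu); rewrite mulmxKV //.
apply: (canRL (mulKmx Nu)); rewrite !mulmxA NN -!mulmxA mulKVmx //.
exact: spd_unit.
Qed.

Lemma pencil_eigenvalue_exists H G : spd H -> G^T = G ->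
  exists a, eigenvalue (invmx H *m G) a.
Proof.
move=> H_spd G_sym.
have [N [T [_ T_sym _ ->]]] := pencil_similar_sym H_spd G_sym.
exact: sym_eigenvalue_exists.
Qed.

(** Since [G = N T N] and [T = L^4], the form at [u] is the squared Euclidean norm of [L L N u]. *)
Lemma pencil_psd H G : spd H -> G^T = G ->
  (forall a, eigenvalue (invmx H *m G) a -> 0 <= a) ->
  forall u, 0 <= bform G u u.
Proof.
move=> H_spd G_sym.
have [N [T [N_sym T_sym GE ->]]] := pencil_similar_sym H_spd G_sym.
move=> /(sym_root4_exists T_sym)[L L_sym LLLL] u.
rewrite GE -[X in X *m _ *m _]N_sym bform_sandwich -LLLL.
rewrite -[X in X *m (_ *m _)](_ : (L *m L)^T = _); last first.
  by rewrite trmx_mul L_sym.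
by rewrite -[X in X *m _]mulmx1 bform_sandwich bform1_ge0.
Qed.

Lemma rayleigh_bounds H G u : spd H -> G^T = G ->
  eigmin (invmx H *m G) * bform H u u <= bform G u u
    <= eigmax (invmx H *m G) * bform H u u.
Proof.
move=> H_spd G_sym; have H_sym := spd_sym H_spd; have Hu := spd_unit H_spd.
have [c c_eig] := pencil_eigenvalue_exists H_spd G_sym.
have [_ min_le] := eigminP c_eig; have [_ max_ge] := eigmaxP c_eig.
(* The bounds are [pencil_psd] for [G - eigmin H] and [eigmax H - G]; [k], equal to 1 or -1, handles
   both shifts at once. *)
have shift (k a b : R) : k != 0 ->
    eigenvalue (invmx H *m (k *: (G - a *: H))) b ->
  eigenvalue (invmx H *m G) (k^-1 * b + a).
  move=> k0 /eigenvalueP[v vE v0]; apply/eigenvalueP; exists v => //.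
  rewrite scalerDl -scalerA -vE -!scalemxAr scalerA mulVf // scale1r.
  by rewrite mulmxBr -scalemxAr mulVmx // mulmxBr -scalemxAr mulmx1 subrK.
have sym k a : (k *: (G - a *: H))^T = k *: (G - a *: H).
  by rewrite linearZ /= linearB /= linearZ /= G_sym H_sym.
have bE k a : bform (k *: (G - a *: H)) u u
    = k * (bform G u u - a * bform H u u).
  by rewrite bform_scalemx bform_addmx bform_oppmx bform_scalemx.
apply/andP; split.
  have := pencil_psd H_spd (sym 1 (eigmin (invmx H *m G))) _ u.
  rewrite bE mul1r subr_ge0; apply.
  move=> a /(shift _ _ _ (oner_neq0 _)) /min_le.
  by rewrite invr1 mul1r lerDr.
have := pencil_psd H_spd (sym (-1) (eigmax (invmx H *m G))) _ u.
rewrite bE mulN1r opprB subr_ge0; apply.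
move=> a /shift; rewrite oppr_eq0 oner_eq0 => /(_ isT) /max_ge.
by rewrite invrN invr1 mulN1r gerDr oppr_le0.
Qed.

Lemma rayleigh_min_attained H G : spd H -> G^T = G -> exists2 u, u != 0 &
  bform G u u = eigmin (invmx H *m G) * bform H u u.
Proof.
move=> H_spd G_sym.
have [c /eigminP[e _]] := pencil_eigenvalue_exists H_spd G_sym.
have [u u0 uE] := pencil_eigenvector (spd_unit H_spd) (spd_sym H_spd) G_sym e.
by exists u; rewrite // -bform_scalemx; apply: bform_eq; rewrite uE scalemxAl.
Qed.

Lemma rayleigh_max_attained H G : spd H -> G^T = G -> exists2 u, u != 0 &
  bform G u u = eigmax (invmx H *m G) * bform H u u.
Proof.
move=> H_spd G_sym.
have [c /eigmaxP[e _]] := pencil_eigenvalue_exists H_spd G_sym.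
have [u u0 uE] := pencil_eigenvector (spd_unit H_spd) (spd_sym H_spd) G_sym e.
by exists u; rewrite // -bform_scalemx; apply: bform_eq; rewrite uE scalemxAl.
Qed.

Lemma rayleigh_in_eigitv H G u : spd H -> G^T = G -> u != 0 ->
  bform G u u / bform H u u \in eigitv (invmx H *m G).
Proof.
move=> H_spd G_sym u0; have Hpos := spd_gt0 H_spd u0.
have /andP[lo hi] := rayleigh_bounds u H_spd G_sym.
by rewrite in_itv /= ler_pdivlMr // ler_pdivrMr // lo hi.
Qed.

End RayleighQuotients.

(** * Inverses of definite and of shifted matrices *)

Lemma spd_inverse_bounds (R : realType) n (G H : 'M[R]_n) (d1 d2 : R) f :
  spd G -> spd H -> 0 <= d1 ->
  (forall u, d1 * bform G u u <= bform H u u <= d2 * bform G u u) ->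
  d1 * bform (invmx H) f f <= bform (invmx G) f f
    <= d2 * bform (invmx H) f f.
Proof.
move=> G_spd H_spd d1_ge0 GH.
have [->|f0] := eqVneq f 0; first by rewrite !bform0r !mulr0 lexx.
have Gu := spd_unit G_spd; have Hu := spd_unit H_spd.
have G_sym := spd_sym G_spd; have H_sym := spd_sym H_spd.
set v := invmx H *m f; set q := invmx G *m f.
have g_gt0 : 0 < bform (invmx H) f f by rewrite spd_gt0 //; exact: spd_invmx.
have h_gt0 : 0 < bform (invmx G) f f by rewrite spd_gt0 //; exact: spd_invmx.
have vE : bform H v v = bform (invmx H) f f.
  by rewrite -[in RHS](mulKVmx Hu f) bform_invmx.
have qE : bform G q q = bform (invmx G) f f.
  by rewrite -[in RHS](mulKVmx Gu f) bform_invmx.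
have vqG : bform G v q = bform (invmx H) f f.
  rewrite -vE; apply: bform_eq; by rewrite !mulKVmx.
have qvH : bform H q v = bform (invmx G) f f.
  rewrite -qE; apply: bform_eq; by rewrite !mulKVmx.
(* Write [g], [h] for the forms of [H^-1], [G^-1] at [f], and [a = bform G v v], [e = bform H q q].
   Cauchy-Schwarz gives [g^2 <= a h] and [h^2 <= e g]; with [d1 a <= g] and [e <= d2 h], dividing by
   [g] and by [h] yields the two bounds. *)
have := bform_cauchy_schwarz v q G_sym (fun x => spd_ge0 x G_spd).
have := bform_cauchy_schwarz q v H_sym (fun x => spd_ge0 x H_spd).
have /andP[lo _] := GH v; have /andP[_ hi] := GH q.
rewrite vqG qvH vE qE in lo hi *.
move: (bform G v v) (bform H q q) lo hi => a e lo hi le_h le_g.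
apply/andP; split.
  rewrite -(ler_pM2r g_gt0).
  apply: le_trans (_ : d1 * (a * bform (invmx G) f f) <= _).
    by rewrite -mulrA -expr2 ler_wpM2l.
  by rewrite mulrA [leRHS]mulrC ler_wpM2r // ltW.
rewrite -(ler_pM2r h_gt0) -expr2; apply: le_trans le_h _.
by rewrite mulrAC ler_wpM2r // ltW.
Qed.

Section ShiftedInverse.
Variables (R : realType) (n : nat) (A Ah : 'M[R]_n.+1) (lam : R).
Hypotheses (A_sym : A^T = A) (Ah_spd : spd Ah).
Hypothesis lam_notin : lam \notin itvA Ah A.

Let H := A - lam *: Ah.

Lemma eigmin_le_eigmax : eigmin (invmx Ah *m A) <= eigmax (invmx Ah *m A).
Proof.
have [c c_eig] := pencil_eigenvalue_exists Ah_spd A_sym.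
by have [e _] := eigminP c_eig; have [_] := eigmaxP e; exact.
Qed.

Lemma shift_cases :
  (lam < eigmin (invmx Ah *m A) /\ spd H) \/
  (eigmax (invmx Ah *m A) < lam /\ spd (- H)).
Proof.
have Ah_sym := spd_sym Ah_spd.
have H_sym : H^T = H by rewrite /H linearB /= linearZ /= A_sym Ah_sym.
have HE u : bform H u u = bform A u u - lam * bform Ah u u.
  by rewrite bform_addmx bform_oppmx bform_scalemx.
move: lam_notin; rewrite in_itv /= negb_and -!ltNge.
case/orP=> [lt|gt]; [left|right].
  split=> //; apply: spdP => // u u0; rewrite HE subr_gt0.
  have /andP[lo _] := rayleigh_bounds u Ah_spd A_sym.
  by apply: lt_le_trans lo; rewrite ltr_pM2r // spd_gt0.
split=> //; apply: spdP => [|u u0]; first by rewrite linearN /= H_sym.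
rewrite bform_oppmx HE opprB subr_gt0.
have /andP[_ hi] := rayleigh_bounds u Ah_spd A_sym.
by apply: le_lt_trans hi _; rewrite ltr_pM2r // spd_gt0.
Qed.

Lemma shift_unit : H \in unitmx.
Proof.
by case: shift_cases => -[_ /spd_unit] //; rewrite -scaleN1r unitmxZ ?unitrN1.
Qed.

(** Below the interval, [A - lam Ah] lies between [eigmin - lam] and [eigmax - lam] times [Ah].
    Passing to inverses keeps these constants, so [lam] plus the quotient of the inverse forms stays
    in the interval. *)
Lemma shifted_inverse_quotient f : f != 0 ->
  exists2 gA, gA \in itvA Ah A &
    bform (invmx H) f f * (gA - lam) = bform (invmx Ah) f f.
Proof.
move=> f0; have bE u : bform H u u = bform A u u - lam * bform Ah u u.
  by rewrite bform_addmx bform_oppmx bform_scalemx.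
have quot (g h d1 d2 : R) : 0 < g -> d1 * g <= h <= d2 * g ->
    d1 <= h / g <= d2.
  by move=> g0 /andP[lo hi]; rewrite ler_pdivlMr // ler_pdivrMr // lo hi.
case: shift_cases => -[lt H_spd].
  have g_gt0 : 0 < bform (invmx H) f f by rewrite spd_gt0 //; exact: spd_invmx.
  exists (lam + bform (invmx Ah) f f / bform (invmx H) f f); last first.
    by rewrite addrAC subrr add0r mulrC divfK // gt_eqF.
  rewrite in_itv /=.
  suff /(quot _ _ _ _ g_gt0)/andP[lo hi] :
      (eigmin (invmx Ah *m A) - lam) * bform (invmx H) f f
      <= bform (invmx Ah) f f
      <= (eigmax (invmx Ah *m A) - lam) * bform (invmx H) f f.
    by apply/andP; split; lra.
  apply: spd_inverse_bounds => // [|u]; first by rewrite subr_ge0 ltW.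
  rewrite bE !mulrBl !lerD2r; exact: rayleigh_bounds.
(* Above the interval [H] is negative definite; the argument is run on [- H] with the endpoints
   exchanged. *)
have iNE : invmx (- H) = - invmx H.
  by rewrite -scaleN1r invmxZ ?unitmxZ ?unitrN1 ?shift_unit // invrN1 scaleN1r.
have := @spd_gt0 _ _ _ f (spd_invmx H_spd) f0.
rewrite iNE bform_oppmx => g_gt0.
exists (lam - bform (invmx Ah) f f / - bform (invmx H) f f); last first.
  by field; rewrite -oppr_eq0 gt_eqF.
rewrite in_itv /=.
suff /(quot _ _ _ _ g_gt0)/andP[lo hi] :
    (lam - eigmax (invmx Ah *m A)) * - bform (invmx H) f f
    <= bform (invmx Ah) f f
    <= (lam - eigmin (invmx Ah *m A)) * - bform (invmx H) f f.
  by apply/andP; split; lra.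
rewrite -bform_oppmx -iNE.
apply: spd_inverse_bounds => // [|u]; first by rewrite subr_ge0 ltW.
rewrite bform_oppmx bE !mulrBl opprB !lerD2l !lerN2 andbC.
exact: rayleigh_bounds.
Qed.

End ShiftedInverse.

(** * Block form of the preconditioner and the eigenvector equations *)

Section SaddleEigenvectors.
Variables (R : realType) (n m p : nat).
Variables (A Ah : 'M[R]_n) (B : 'M[R]_(m, n)) (Sh : 'M[R]_m).
Variables (C : 'M[R]_(p, m)) (E Xh : 'M[R]_p) (lam : R).
Hypotheses (A_sym : A^T = A) (E_sym : E^T = E).
Hypotheses (Ah_spd : spd Ah) (Sh_spd : spd Sh) (Xh_spd : spd Xh).

Lemma precE : prec Ah B Sh C Xh =
  block_mx (block_mx Ah B^T B (schurS Ah B + Sh)) (col_mx 0 (- C^T))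
           (row_mx 0 (- C)) (C *m invmx Sh *m C^T + Xh).
Proof.
have Ahu := spd_unit Ah_spd; have Shu := spd_unit Sh_spd.
have Xhu := spd_unit Xh_spd.
have Ah_sym := spd_sym Ah_spd; have Sh_sym := spd_sym Sh_spd.
have Xh_sym := spd_sym Xh_spd.
have D_unit : precD Ah Sh Xh \in unitmx.
  by rewrite unitmxE !det_ublock !unitrM -!unitmxE Ahu Shu Xhu.
(* Closed form of [P_D^-1 P_L^T]; its diagonal blocks are identities up to the sign that [- Sh]
   produces. *)
pose U : 'M[R]_(n + m + p) :=
  block_mx (block_mx 1%:M (invmx Ah *m B^T) 0 (- 1%:M))
           (col_mx 0 (invmx Sh *m C^T)) 0 1%:M.
have DU : invmx (precD Ah Sh Xh) *m (precL Ah B Sh C Xh)^T = U.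
  apply: (canLR (mulKmx D_unit)); rewrite /precL /precD /U.
  rewrite !tr_block_mx tr_row_mx !trmx0 linearN /= Ah_sym Sh_sym Xh_sym.
  rewrite !mulmx_block !mul_block_col !mulmx0 !mul0mx !mulmx1 !addr0 !add0r.
  by rewrite !mulmxA !mulmxV // !mul1mx mulmxN mulmx1.
rewrite /prec -mulmxA DU /precL /U !mulmx_block !mul_block_col !mul_row_block.
rewrite !mul_row_col !mulmx0 !mul0mx !mulmx1 !addr0 !add0r.
rewrite !mulmxN !mulNmx !mulmx1 opprK mulKVmx // mulKVmx //.
by rewrite /schurS !mulmxA.
Qed.

Lemma prec_unit : prec Ah B Sh C Xh \in unitmx.
Proof.
have Ahu := spd_unit Ah_spd; have Shu := spd_unit Sh_spd.
have Xhu := spd_unit Xh_spd.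
rewrite /prec !unitmx_mul unitmx_inv unitmx_tr andbC andbA andbb.
rewrite !unitmxE /precL /precD !det_ublock !det_lblock !unitrM -!unitmxE.
rewrite Ahu Shu Xhu.
by rewrite -scaleN1r unitmxZ ?unitrN1 ?Shu.
Qed.

Lemma prec_sym : (prec Ah B Sh C Xh)^T = prec Ah B Sh C Xh.
Proof.
rewrite precE !tr_block_mx tr_row_mx tr_col_mx !trmx0 !linearD !linearN /=.
rewrite !trmxK.
have Ah_sym := spd_sym Ah_spd; have Sh_sym := spd_sym Sh_spd.
have Xh_sym := spd_sym Xh_spd.
by rewrite /schurS !trmx_mul !trmxK !invmx_sym // Ah_sym Sh_sym Xh_sym !mulmxA.
Qed.

Lemma saddle_sym : (saddle A B C E)^T = saddle A B C E.
Proof.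
by rewrite /saddle !tr_block_mx tr_row_mx tr_col_mx !trmx0 !trmxK A_sym E_sym.
Qed.

Lemma saddle_eigenvector :
  eigenvalue (invmx (prec Ah B Sh C Xh) *m saddle A B C E) lam ->
  exists (x : 'cV[R]_n) (y : 'cV[R]_m) (z : 'cV[R]_p),
  [/\ [|| x != 0, y != 0 | z != 0],
    A *m x + B^T *m y = lam *: (Ah *m x + B^T *m y),
    B *m x + C^T *m z
      = lam *: (B *m x + (schurS Ah B + Sh) *m y - C^T *m z) &
    C *m y + E *m z
      = lam *: (- (C *m y) + (C *m invmx Sh *m C^T + Xh) *m z)].
Proof.
move=> /(pencil_eigenvector prec_unit prec_sym saddle_sym)[u u0].
rewrite -[u]vsubmxK -[usubmx u]vsubmxK in u0 *.
move: (usubmx (usubmx u)) (dsubmx (usubmx u)) (dsubmx u) u0 => x y z u0.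
rewrite precE /saddle !mul_block_col !mul_row_col !mul_col_mx !add_col_mx.
rewrite !scale_col_mx !mul0mx !addr0 !add0r !mulNmx.
move=> /eq_col_mx[/eq_col_mx[e1 e2] e3]; exists x, y, z; split=> //.
by move: u0; rewrite !col_mx_eq0 !negb_and -orbA.
Qed.

End SaddleEigenvectors.

Lemma segment_in_itv (R : realDomainType) (l u x y t : R) : 0 <= t <= 1 ->
  x \in `[l, u] -> y \in `[l, u] -> x + t * (y - x) \in `[l, u].
Proof.
rewrite !in_itv /= => /andP[t_ge0 t_le1] /andP[lx xu] /andP[ly yu].
rewrite (_ : _ + _ = (1 - t) * x + t * y); last by ring.
have tE v : v = (1 - t) * v + t * v by ring.
by apply/andP; split; [rewrite [leLHS]tE | rewrite [leRHS]tE];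
  rewrite lerD // ler_wpM2l // subr_ge0.
Qed.

(** * Elimination of [x] and the reduced equations *)

Section ReducedEquations.
Variables (R : realType) (n m : nat).
Variables (A Ah : 'M[R]_n.+1) (B : 'M[R]_(m.+1, n.+1)) (Sh : 'M[R]_m.+1).
Variables (C E Xh : 'M[R]_m.+1) (lam : R).
Hypotheses (A_sym : A^T = A) (E_spsd : spsd E) (B_full : row_free B).
Hypotheses (Ah_spd : spd Ah) (Sh_spd : spd Sh) (Xh_spd : spd Xh).
Hypothesis C_unit : C \in unitmx.
Hypothesis lam_notin : lam \notin itvA Ah A.

Definition My : 'M[R]_m.+1 := lam *: (Sh + schurS Ah B)
  + (1 - lam) ^+ 2 *: (B *m invmx (A - lam *: Ah) *m B^T).

Definition Nz : 'M[R]_m.+1 := lam *: (Xh + C *m invmx Sh *m C^T) - E.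

Let E_sym : E^T = E.
Proof. exact: spsd_sym. Qed.

Lemma schurS_sym : (schurS Ah B)^T = schurS Ah B.
Proof.
by rewrite /schurS !trmx_mul trmxK (invmx_sym (spd_sym Ah_spd)) mulmxA.
Qed.

Lemma CSC_sym : (C *m invmx Sh *m C^T)^T = C *m invmx Sh *m C^T.
Proof. by rewrite !trmx_mul trmxK (invmx_sym (spd_sym Sh_spd)) mulmxA. Qed.

Lemma schurX_sym : (schurX Sh C E)^T = schurX Sh C E.
Proof. by rewrite /schurX linearD /= E_sym CSC_sym. Qed.

Lemma My_sym : My^T = My.
Proof.
have iH_sym : (invmx (A - lam *: Ah))^T = invmx (A - lam *: Ah).
  by rewrite invmx_sym // linearB /= linearZ /= A_sym (spd_sym Ah_spd).
rewrite /My linearD /= linearZ /= linearZ /= linearD /=.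
rewrite (spd_sym Sh_spd) schurS_sym.
by rewrite !trmx_mul trmxK iH_sym mulmxA.
Qed.

Lemma Nz_sym : Nz^T = Nz.
Proof.
by rewrite /Nz linearB /= linearZ /= linearD /= (spd_sym Xh_spd) CSC_sym E_sym.
Qed.

Lemma trB_neq0 (y : 'cV[R]_m.+1) : y != 0 -> B^T *m y != 0.
Proof.
apply: contra_neq => By; apply: trmx_inj; apply: (row_free_inj B_full).
by rewrite trmx0 mul0mx -[B]trmxK -trmx_mul By trmx0.
Qed.

Lemma reduced_eigenvector :
  eigenvalue (invmx (prec Ah B Sh C Xh) *m saddle A B C E) lam ->
  exists y z : 'cV[R]_m.+1, [/\ y != 0 \/ z != 0,
    My *m y = (1 + lam) *: (C^T *m z) & Nz *m z = (1 + lam) *: (C *m y)].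
Proof.
move=> /(saddle_eigenvector A_sym E_sym Ah_spd Sh_spd Xh_spd).
move=> [x [y [z [xyz e1 e2 e3]]]]; exists y, z.
have Hu := shift_unit A_sym Ah_spd lam_notin.
(* The first block row reads [(A - lam Ah) x = (lam - 1) B^T y]. *)
have xE : x = (lam - 1) *: (invmx (A - lam *: Ah) *m (B^T *m y)).
  rewrite scalemxAr; apply: (canRL (mulKmx Hu)); rewrite mulmxBl -scalemxAl.
  apply/eqP; rewrite subr_eq; apply/eqP; apply: (addIr (B^T *m y)).
  by rewrite e1 scalerBl scale1r scalerDr addrAC subrK addrC.
split.
- case/or3P: xyz => [x0|y0|z0]; [left|by left|by right].
  by apply: contra_neq x0 => y0; rewrite xE y0 !mulmx0 scaler0.
(* [B x] enters the second row with factor [1 - lam] and itself carries [lam - 1]; hence the square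
   in [My]. *)
- have Bx : B *m x = (lam - 1) *: (B *m invmx (A - lam *: Ah) *m B^T *m y).
    by rewrite xE -scalemxAr !mulmxA.
  have -> : My *m y = lam *: ((schurS Ah B + Sh) *m y)
      + (1 - lam) ^+ 2 *: (B *m invmx (A - lam *: Ah) *m B^T *m y).
    by rewrite /My mulmxDl -!scalemxAl [Sh + _]addrC.
  move: e2; rewrite Bx.
  move: (_ *m B^T *m y) ((_ + Sh) *m y) (C^T *m z) => q s c e2.
  apply/matrixP => i j; move/matrixP: e2 => /(_ i j); rewrite !mxE; lra.
- move: e3; rewrite /Nz mulmxBl -scalemxAl [Xh + _]addrC.
  move: (C *m y) (E *m z) ((_ + Xh) *m z) => c e s e3.
  apply/matrixP => i j; move/matrixP: e3 => /(_ i j); rewrite !mxE; lra.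
Qed.

(** The test vector [y0] is free because the later Cauchy-Schwarz comparisons pair the reduced
    equation with vectors other than [y]. *)
Lemma bform_My (y0 y z : 'cV[R]_m.+1) :
  My *m y = (1 + lam) *: (C^T *m z) ->
  bform My y0 y = (1 + lam) * bform Sh y0 (invmx Sh *m (C^T *m z)).
Proof.
move=> e; rewrite -bform_scalemx; apply: bform_eq.
by rewrite e -scalemxAl mulKVmx ?spd_unit.
Qed.

Lemma bform_Nz (y z z0 : 'cV[R]_m.+1) :
  Nz *m z = (1 + lam) *: (C *m y) ->
  bform Nz z0 z = (1 + lam) * bform Sh y (invmx Sh *m (C^T *m z0)).
Proof.
have Shu := spd_unit Sh_spd.
move=> e; have -> : bform Nz z0 z = bform ((1 + lam) *: C) z0 y.
  by apply: bform_eq; rewrite e scalemxAl.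
rewrite bform_scalemx -bform_tr. congr (_ * _); apply: bform_eq.
by rewrite mulKVmx.
Qed.

Lemma bform_CSC (z : 'cV[R]_m.+1) (w := invmx Sh *m (C^T *m z)) :
  bform (C *m invmx Sh *m C^T) z z = bform Sh w w.
Proof.
have Shu := spd_unit Sh_spd; rewrite -{1}[C]trmxK bform_sandwich.
by rewrite -[in LHS](mulKVmx Shu (C^T *m z)) bform_invmx ?(spd_sym Sh_spd).
Qed.

(** * Parameters as Rayleigh quotients *)

Lemma bform_BGB (G : 'M[R]_n.+1) (y : 'cV[R]_m.+1) :
  bform (B *m G *m B^T) y y = bform G (B^T *m y) (B^T *m y).
Proof. by rewrite -{1}[B]trmxK bform_sandwich. Qed.

(** [gR] is the quotient of [schurS] at [y], and [gA] comes from the shifted inverse at [B^T y]. The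
    last term of [My] then contributes [(1 - lam)^2 gR / (gA - lam)], and clearing the denominator
    leaves [- p_pol]. *)
Lemma gamma_AR_exist (y : 'cV[R]_m.+1) : y != 0 ->
  exists gA gR, [/\ gA \in itvA Ah A, gR \in itvR Ah B Sh &
    (gA - lam) * bform My y y = - p_pol lam gA gR * bform Sh y y].
Proof.
move=> y0; have y_gt0 := spd_gt0 Sh_spd y0.
have [gA gA_in gAE] :=
  shifted_inverse_quotient A_sym Ah_spd lam_notin (trB_neq0 y0).
exists gA, (bform (schurS Ah B) y y / bform Sh y y); split=> //.
  by apply: rayleigh_in_eigitv => //; exact: schurS_sym.
rewrite /My bform_addmx !bform_scalemx bform_addmx !bform_BGB -gAE /p_pol.
by field; exact: lt0r_neq0.
Qed.

(** Conjugation by [sqrtmx (invmx Xh)] removes the square roots, so that [gK] can be a Rayleigh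
    quotient relative to [Xh]. *)
Lemma eigitv_K :
  itvK Sh C Xh = eigitv (invmx Xh *m (C *m invmx Sh *m C^T)).
Proof.
rewrite /itvK /eigitv /eigmin /eigmax /Kmx.
have [] := sqrtmxP (spd_invmx Xh_spd); have [] := sqrtmxP (spd_invmx Sh_spd).
move: (sqrtmx (invmx Xh)) (sqrtmx (invmx Sh)) => X S S_spd <- X_spd <-.
rewrite (eigenvalue_similar (H := X *m X *m (C *m (S *m S) *m C^T))
                            (spd_unit X_spd)) //.
by rewrite !trmx_mul (spd_sym X_spd) (spd_sym S_spd) !mulmxA.
Qed.

(** The condition on [gK + gE] couples two parameters, but linearly, so the admissible set stays
    convex. *)
Definition gammas_in (gA gR gK gE : R) : Prop :=
  [/\ gA \in itvA Ah A, gR \in itvR Ah B Sh, gK \in itvK Sh C Xh,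
      gE \in itvE E Xh & gK + gE \in itvX Sh C E Xh].

(** Both quotients are taken at the same [z], so their sum is the quotient of [schurX] there. *)
Lemma gamma_KE_exist (z : 'cV[R]_m.+1) (w := invmx Sh *m (C^T *m z)) :
  z != 0 ->
  exists gK gE, [/\ gK \in itvK Sh C Xh, gE \in itvE E Xh &
    gK + gE \in itvX Sh C E Xh] /\
  [/\ gK * bform Xh z z = bform Sh w w,
    (gK + gE) * bform Xh z z = bform (schurX Sh C E) z z &
    (lam * (1 + gK) - gE) * bform Xh z z = bform Nz z z].
Proof.
move=> z0; have z_gt0 := spd_gt0 Xh_spd z0.
exists (bform (C *m invmx Sh *m C^T) z z / bform Xh z z),
       (bform E z z / bform Xh z z); split; split.
- by rewrite eigitv_K; apply: rayleigh_in_eigitv => //; exact: CSC_sym.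
- exact: rayleigh_in_eigitv.
- rewrite -mulrDl addrC -bform_addmx; apply: rayleigh_in_eigitv => //.
  exact: schurX_sym.
- by rewrite divfK ?gt_eqF // bform_CSC.
- by rewrite -mulrDl divfK ?gt_eqF // addrC -bform_addmx.
rewrite /Nz bform_addmx bform_oppmx bform_scalemx bform_addmx.
by field; exact: lt0r_neq0.
Qed.

Lemma gammas_in_convex (a r k e a' r' k' e' t : R) : 0 <= t <= 1 ->
  gammas_in a r k e -> gammas_in a' r' k' e' ->
  gammas_in (a + t * (a' - a)) (r + t * (r' - r)) (k + t * (k' - k))
            (e + t * (e' - e)).
Proof.
move=> t01 [a_in r_in k_in e_in x_in] [a'_in r'_in k'_in e'_in x'_in].
split; [exact: segment_in_itv a_in a'_in | exact: segment_in_itv r_in r'_in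
       | exact: segment_in_itv k_in k'_in | exact: segment_in_itv e_in e'_in |].
rewrite (_ : k + _ + _ = k + e + t * (k' + e' - (k + e))); last by ring.
exact: segment_in_itv x_in x'_in.
Qed.

(** * Sign of [piE_pol] and the intermediate value theorem *)

Lemma piE_root_between (a r k e a' r' k' e' : R) :
  gammas_in a r k e -> gammas_in a' r' k' e' ->
  piE_pol lam a r k e <= 0 <= piE_pol lam a' r' k' e' ->
  exists gA gR gK gE, gammas_in gA gR gK gE /\ piE_pol lam gA gR gK gE = 0.
Proof.
move=> g_in g'_in sgn.
(* Along the segment joining the two parameter points, [piE_pol] is a polynomial [f] in the segment
   parameter. *)
pose line (x x' : R) : {poly R} := x%:P + 'X * (x' - x)%:P.
pose P : {poly R} := line a a'; pose Q := line r r'.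
pose K := line k k'; pose F := line e e'.
pose p := (lam ^+ 2)%:P - lam%:P * (P * Q + P - 2%:P * Q) - Q.
pose f := ((1 + lam) ^+ 2)%:P * (P - lam%:P) * K + p * (lam%:P * (1 + K) - F).
have fE t : f.[t] = piE_pol lam (a + t * (a' - a)) (r + t * (r' - r))
                            (k + t * (k' - k)) (e + t * (e' - e)).
  rewrite /f /p /P /Q /K /F /line.
  rewrite !(hornerD, hornerN, hornerM, hornerC, hornerX).
  by rewrite /piE_pol /pi_pol /p_pol; ring.
have [|t t01 /rootP ft] := @poly_ivt _ f 0 1 ler01.
  by rewrite !fE !mul0r !mul1r !addr0 ![_ + (_ - _)]addrC !subrK.
rewrite fE in ft; do 4!eexists; split; last exact: ft.
exact: gammas_in_convex.
Qed.

(** Collecting [p_pol] gives [(1 + lam)^2 (a - lam) k + p_pol (lam (1 + k) - e)]; the factors [s]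
    and [q] clear the denominators of the quotients. *)
Lemma piE_factor (a r k e s q My0 Nz0 b : R) :
  (a - lam) * My0 = - p_pol lam a r * s -> k * q = b ->
  (lam * (1 + k) - e) * q = Nz0 ->
  piE_pol lam a r k e * (s * q)
    = (a - lam) * ((1 + lam) ^+ 2 * (s * b) - My0 * Nz0).
Proof.
move=> MyE <- <-.
have -> : piE_pol lam a r k e = (1 + lam) ^+ 2 * (a - lam) * k
    + p_pol lam a r * (lam * (1 + k) - e).
  by rewrite /piE_pol /pi_pol; ring.
have pE : p_pol lam a r * s = - ((a - lam) * My0) by rewrite MyE mulNr opprK.
apply/eqP; rewrite -subr_eq0; set N := lam * (1 + k) - e.
rewrite [_ - _](_ : _ = (p_pol lam a r * s + (a - lam) * My0) * (N * q)).
  by rewrite pE addNr mul0r.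
by ring.
Qed.

(** As [1 + lam] is nonzero and [C] invertible, the reduced equations make [y] and [z] vanish
    together. *)
Lemma eigenvector_neq0 : lam != -1 ->
  eigenvalue (invmx (prec Ah B Sh C Xh) *m saddle A B C E) lam ->
  exists y z : 'cV[R]_m.+1, [/\ y != 0, z != 0,
    My *m y = (1 + lam) *: (C^T *m z) & Nz *m z = (1 + lam) *: (C *m y)].
Proof.
rewrite -addr_eq0 addrC => lam1 /reduced_eigenvector[y [z [yz My_eq Nz_eq]]].
have CTu : C^T \in unitmx by rewrite unitmx_tr.
have yz0 : (y == 0) = (z == 0).
  apply/eqP/eqP => e0.
    move/eqP: My_eq; rewrite e0 mulmx0 eq_sym scaler_eq0 (negPf lam1) /=.
    by move=> /eqP Cz; rewrite -[z](mulKmx CTu) Cz mulmx0.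
  move/eqP: Nz_eq; rewrite e0 mulmx0 eq_sym scaler_eq0 (negPf lam1) /=.
  by move=> /eqP Cy; rewrite -[y](mulKmx C_unit) Cy mulmx0.
exists y, z; split=> //; first by rewrite yz0; case: yz; rewrite ?yz0.
by rewrite -yz0; case: yz; rewrite ?yz0.
Qed.

(** The factor [(1 + lam)^2 gK - mu nu], scaled by [bform Sh y y * bform Xh z z] so as to be free of
    the parameters. *)
Definition disc (y z : 'cV[R]_m.+1) (w := invmx Sh *m (C^T *m z)) : R :=
  (1 + lam) ^+ 2 * (bform Sh y y * bform Sh w w) - bform My y y * bform Nz z z.

(** The pair [gA], [gR] depends on [y] only and [gK], [gE] on [z] only, so [y] and [z] may come from
    different vectors. *)
Lemma piE_at_vectors (y z : 'cV[R]_m.+1) : y != 0 -> z != 0 ->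
  exists gA gR gK gE, gammas_in gA gR gK gE /\
    piE_pol lam gA gR gK gE * (bform Sh y y * bform Xh z z)
      = (gA - lam) * disc y z.
Proof.
move=> y0 z0.
have [gA [gR [gA_in gR_in AR_eq]]] := gamma_AR_exist y0.
have [gK [gE [[gK_in gE_in gX_in] [K_eq _ E_eq]]]] := gamma_KE_exist z0.
exists gA, gR, gK, gE; split; first exact: (And5 gA_in gR_in gK_in gE_in gX_in).
exact: piE_factor.
Qed.

(** Both [My] at [y] and [Nz] at [z] give [(1 + lam) bform Sh y w], so [disc] is [(1 + lam)^2] times
    a Cauchy-Schwarz defect. *)
Lemma disc_eigenvector_ge0 (y z : 'cV[R]_m.+1) :
  My *m y = (1 + lam) *: (C^T *m z) -> Nz *m z = (1 + lam) *: (C *m y) ->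
  0 <= disc y z.
Proof.
move=> My_eq Nz_eq; rewrite /disc (bform_My _ My_eq) (bform_Nz _ Nz_eq).
set w := invmx Sh *m (C^T *m z).
have := bform_cauchy_schwarz y w (spd_sym Sh_spd) (fun u => spd_ge0 u Sh_spd).
move: (bform Sh y y * bform Sh w w) (bform Sh y w) => ab c cs.
have -> : (1 + lam) ^+ 2 * ab - (1 + lam) * c * ((1 + lam) * c)
  = (1 + lam) ^+ 2 * (ab - c ^+ 2) by ring.
by rewrite mulr_ge0 ?sqr_ge0 // subr_ge0.
Qed.

(** * Opposite signs in the three ranges of [lam] *)

Lemma piE_root_small (y z y' z' : 'cV[R]_m.+1) :
  lam < eigmin (invmx Ah *m A) ->
  y != 0 -> z != 0 -> y' != 0 -> z' != 0 -> 0 <= disc y z -> disc y' z' <= 0 ->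
  exists gA gR gK gE, gammas_in gA gR gK gE /\ piE_pol lam gA gR gK gE = 0.
Proof.
move=> lam_lt y0 z0 y'0 z'0 d_ge0 d'_le0.
(* Every admissible [gA] exceeds [lam], so [piE_pol] has the sign of [disc]. *)
have gA_gt gA gR gK gE : gammas_in gA gR gK gE -> 0 < gA - lam.
  case; rewrite in_itv /= => /andP[gA_ge _] _ _ _ _.
  by rewrite subr_gt0; exact: lt_le_trans gA_ge.
have [a [r [k [e [g_in piE_eq]]]]] := piE_at_vectors y0 z0.
have [a' [r' [k' [e' [g'_in piE'_eq]]]]] := piE_at_vectors y'0 z'0.
apply: (piE_root_between g'_in g_in); apply/andP; split.
  rewrite -(pmulr_lle0 _ (_ : 0 < bform Sh y' y' * bform Xh z' z')).
    by rewrite piE'_eq pmulr_rle0 // (gA_gt _ _ _ _ g'_in).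
  by rewrite mulr_gt0 ?spd_gt0.
rewrite -(pmulr_lge0 _ (_ : 0 < bform Sh y y * bform Xh z z)).
  by rewrite piE_eq pmulr_rge0 // (gA_gt _ _ _ _ g_in).
by rewrite mulr_gt0 ?spd_gt0.
Qed.

(** Eigenvectors for the extreme eigenvalues of the [schurX] pencil give pairs whose sums are the
    endpoints of its interval; some pair on the segment between them sums to 1. *)
Lemma gamma_KE_sum1 : 1 \in itvX Sh C E Xh ->
  exists gK gE, [/\ gK \in itvK Sh C Xh, gE \in itvE E Xh & gK + gE = 1].
Proof.
rewrite in_itv /= => /andP[min_le1 max_ge1].
have [z z0 zE] := rayleigh_min_attained Xh_spd schurX_sym.
have [z' z'0 z'E] := rayleigh_max_attained Xh_spd schurX_sym.
have [k [e [[k_in e_in _] [_ s_eq _]]]] := gamma_KE_exist z0.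
have [k' [e' [[k'_in e'_in _] [_ s'_eq _]]]] := gamma_KE_exist z'0.
rewrite zE in s_eq; rewrite z'E in s'_eq.
have := mulIf (lt0r_neq0 (spd_gt0 Xh_spd z0)) s_eq => {zE}s_eq.
have := mulIf (lt0r_neq0 (spd_gt0 Xh_spd z'0)) s'_eq => {z'E}s'_eq.
rewrite -s_eq in min_le1; rewrite -s'_eq in max_ge1.
have [t t01 tE] : exists2 t : R, 0 <= t <= 1
    & k + e + t * (k' + e' - (k + e)) = 1.
  move: (k + e) (k' + e') min_le1 max_ge1 => s s' s_le1 s'_ge1.
  (* The denominator [s' - s] used below may vanish when [s = 1]. *)
  have [s_eq1|s_neq1] := eqVneq s 1.
    by exists 0; rewrite ?lexx ?ler01 // mul0r addr0.
  have s's : 0 < s' - s.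
    by rewrite subr_gt0 (lt_le_trans _ s'_ge1) // lt_neqAle s_neq1.
  exists ((1 - s) / (s' - s)); last by field; exact: lt0r_neq0.
  rewrite divr_ge0 ?(ltW s's) ?subr_ge0 //=.
  by rewrite ler_pdivrMr // mul1r lerD2r.
exists (k + t * (k' - k)), (e + t * (e' - e)); split.
- exact: segment_in_itv k_in k'_in.
- exact: segment_in_itv e_in e'_in.
by rewrite -[RHS]tE; ring.
Qed.

Lemma piE_root_large :
  eigmin (invmx Ah *m A) < 1 -> 1 < eigmax (invmx Ah *m A) ->
  1 \in itvR Ah B Sh -> 1 \in itvX Sh C E Xh ->
  eigenvalue (invmx (prec Ah B Sh C Xh) *m saddle A B C E) lam ->
  eigmax (invmx Ah *m A) < lam ->
  exists gA gR gK gE, gammas_in gA gR gK gE /\ piE_pol lam gA gR gK gE = 0.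
Proof.
move=> min_lt1 max_gt1 R_1 X_1 lam_eig max_lt.
have lam_gt1 : 1 < lam by exact: lt_trans max_lt.
have [|y [z [y0 z0 My_eq Nz_eq]]] := eigenvector_neq0 _ lam_eig; first by lra.
have [gA [gR [gK [gE [g_in piE_eq]]]]] := piE_at_vectors y0 z0.
have gA_lt : gA - lam < 0.
  case: g_in; rewrite in_itv /= => /andP[_ gA_le] _ _ _ _.
  by rewrite subr_lt0; exact: le_lt_trans max_lt.
have piE_le0 : piE_pol lam gA gR gK gE <= 0.
  rewrite -(pmulr_lle0 _ (_ : 0 < bform Sh y y * bform Xh z z)).
    by rewrite piE_eq nmulr_rle0 // disc_eigenvector_ge0.
  by rewrite mulr_gt0 ?spd_gt0.
have [k [e [k_in e_in ke1]]] := gamma_KE_sum1 X_1.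
have A_1 : 1 \in itvA Ah A by rewrite in_itv /= !ltW.
have ke_in : k + e \in itvX Sh C E Xh by rewrite ke1; exact: X_1.
have eE : e = 1 - k by rewrite -ke1 addrC addKr.
apply: (piE_root_between g_in (And5 A_1 R_1 k_in e_in ke_in)).
(* At [gA = gR = 1], [p_pol] is [lam^2 - 1], and [k] cancels once [e = 1 - k]. *)
rewrite piE_le0 (_ : piE_pol _ _ _ _ _ = (lam - 1) ^+ 2 * (lam + 1)).
  by rewrite mulr_ge0 ?sqr_ge0 //; lra.
by rewrite eE /piE_pol /pi_pol /p_pol; ring.
Qed.

Lemma piE_root_nonneg :
  eigmin (invmx Ah *m A) < 1 ->
  eigenvalue (invmx (prec Ah B Sh C Xh) *m saddle A B C E) lam ->
  0 <= lam -> lam < eigmin (invmx Ah *m A) ->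
  exists gA gR gK gE, gammas_in gA gR gK gE /\ piE_pol lam gA gR gK gE = 0.
Proof.
move=> min_lt1 lam_eig lam_ge0 lam_lt.
have My_spd : spd My.
  apply: spdP => [|u u0]; first exact: My_sym.
  have [[_ H_spd]|[lt _]] := shift_cases A_sym Ah_spd lam_notin; last first.
    by have := eigmin_le_eigmax A_sym Ah_spd; lra.
  rewrite /My bform_addmx !bform_scalemx bform_addmx.
  (* As [lam] may be 0, strictness comes from the [(1 - lam)^2] term, where [lam < 1]. *)
  rewrite /schurS !bform_BGB ltr_wpDl //.
    rewrite mulr_ge0 // addr_ge0 ?spd_ge0 //; exact: spd_invmx.
  rewrite mulr_gt0 ?exprn_even_gt0 //=; first by lra.
  by rewrite spd_gt0 ?trB_neq0 //; exact: spd_invmx.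
have [|y [z [y0 z0 My_eq Nz_eq]]] := eigenvector_neq0 _ lam_eig; first by lra.
have w_neq0 : invmx Sh *m (C^T *m z) != 0.
  apply: contra_neq z0 => w0; have CTu : C^T \in unitmx by rewrite unitmx_tr.
  rewrite -[z](mulKmx CTu) -[C^T *m z](mulKVmx (spd_unit Sh_spd)) w0.
  by rewrite !mulmx0.
apply: (piE_root_small lam_lt y0 z0 w_neq0 z0).
  exact: disc_eigenvector_ge0.
set w := invmx Sh *m (C^T *m z).
(* The reduced equations give [My(w,y) = (1 + lam) Sh(w,w)] and [My(y,y) = Nz(z,z)], so [disc w z]
   is [My(w,y)^2 - My(w,w) My(y,y)]. *)
have := bform_cauchy_schwarz w y (spd_sym My_spd) (fun u => spd_ge0 u My_spd).
rewrite /disc -/w (bform_My w My_eq) (bform_My y My_eq) (bform_Nz z Nz_eq) -/w.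
by rewrite subr_le0 exprMn expr2 -expr2.
Qed.

Lemma piE_root_neg : lam < 0 -> lam < eigmin (invmx Ah *m A) ->
  eigenvalue (invmx (prec Ah B Sh C Xh) *m saddle A B C E) lam ->
  exists gA gR gK gE, gammas_in gA gR gK gE /\ piE_pol lam gA gR gK gE = 0.
Proof.
move=> lam_lt0 lam_lt lam_eig.
have CTu : C^T \in unitmx by rewrite unitmx_tr.
have Shu := spd_unit Sh_spd.
have NzN_spd : spd (- Nz).
  apply: spdP => [|u u0]; first by rewrite linearN /= Nz_sym.
  rewrite bform_oppmx /Nz bform_addmx bform_oppmx bform_scalemx bform_addmx.
  rewrite opprB ltr_wpDl //; first exact: spsd_ge0.
  rewrite -mulNr mulr_gt0 ?oppr_gt0 // ltr_pwDl ?spd_gt0 //.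
  by rewrite bform_CSC spd_ge0.
(* Inverts the passage from [z] to [w]: the pair [y], [lift y] has [w = y]. *)
pose lift (y : 'cV[R]_m.+1) := invmx C^T *m (Sh *m y).
have liftK y : invmx Sh *m (C^T *m lift y) = y by rewrite !mulKVmx // mulKmx.
have lift_neq0 y : y != 0 -> lift y != 0.
  by apply: contra_neq => e; rewrite -(liftK y) e !mulmx0.
have [lamE|lam_neq] := eqVneq lam (-1); last first.
  have [y [z [y0 z0 My_eq Nz_eq]]] := eigenvector_neq0 lam_neq lam_eig.
  apply: (piE_root_small lam_lt y0 z0 y0 (lift_neq0 y y0)).
    exact: disc_eigenvector_ge0.
  (* Likewise [disc y (lift y)] is [Nz(lift y,z)^2 - Nz(lift y,lift y) Nz(z,z)]. *)
  have := bform_cauchy_schwarz (lift y) z (spd_sym NzN_spd)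
    (fun u => spd_ge0 u NzN_spd).
  rewrite /disc liftK (bform_My y My_eq) !bform_oppmx sqrrN mulrNN.
  rewrite (bform_Nz (lift y) Nz_eq) (bform_Nz z Nz_eq) liftK subr_le0 exprMn.
  by rewrite [X in _ <= X]mulrC.
(* At [lam = -1] both right-hand sides vanish, and definiteness of [- Nz] leaves [z = 0], hence
   [y != 0]. *)
have [y [z [yz My_eq Nz_eq]]] := reduced_eigenvector lam_eig.
have lam1 : 1 + lam = 0 by rewrite lamE subrr.
rewrite lam1 scale0r in My_eq; rewrite lam1 scale0r in Nz_eq.
have NzNu := spd_unit NzN_spd.
have z0 : z = 0.
  have Nz0 : - Nz *m z = 0 by rewrite mulNmx Nz_eq oppr0.
  by rewrite -[z](mulKmx NzNu) Nz0 mulmx0.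
have y0 : y != 0 by case: yz => //; rewrite z0 eqxx.
(* Any nonzero second vector would do: [disc] vanishes because [1 + lam] and [bform My y y] do. *)
have [gA [gR [gK [gE [g_in]]]]] := piE_at_vectors y0 (lift_neq0 y y0).
have My_yy : bform My y y = 0 by rewrite /bform -mulmxA My_eq mulmx0 mxE.
rewrite /disc lam1 My_yy expr0n !mul0r subrr mulr0 => /eqP.
rewrite mulf_eq0 (gt_eqF (mulr_gt0 _ _)) ?spd_gt0 ?lift_neq0 // orbF => /eqP.
by exists gA, gR, gK, gE.
Qed.

Lemma piE_root_exists :
  eigmin (invmx Ah *m A) < 1 -> 1 < eigmax (invmx Ah *m A) ->
  1 \in itvR Ah B Sh -> 1 \in itvX Sh C E Xh ->
  eigenvalue (invmx (prec Ah B Sh C Xh) *m saddle A B C E) lam ->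
  exists gA gR gK gE, gammas_in gA gR gK gE /\ piE_pol lam gA gR gK gE = 0.
Proof.
move=> min_lt1 max_gt1 R_1 X_1 lam_eig.
have [[lt _]|[lt _]] := shift_cases A_sym Ah_spd lam_notin; last first.
  exact: piE_root_large.
have [lam_ge0|lam_lt0] := leP 0 lam; first exact: piE_root_nonneg.
exact: piE_root_neg.
Qed.

End ReducedEquations.

Theorem theorem4p1 (R : realType) (n m : nat)
  (A Ah : 'M[R]_n) (B : 'M[R]_(m, n)) (Sh : 'M[R]_m)
  (C E Xh : 'M[R]_m)
  (m_gt0 : (0 < m)%N) (le_mn : (m <= n)%N)
  (A_spd : spd A) (B_full : row_free B) (C_nonsing : C \in unitmx)
  (E_spsd : spsd E)
  (Ah_spd : spd Ah) (Sh_spd : spd Sh) (Xh_spd : spd Xh)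
  (minA_lt1 : eigmin (invmx Ah *m A) < 1)
  (maxA_gt1 : 1 < eigmax (invmx Ah *m A))
  (maxA_lt2 : eigmax (invmx Ah *m A) < 2)
  (R_1 : 1 \in itvR Ah B Sh)
  (X_1 : 1 \in itvX Sh C E Xh)
  (lam : R)
  (lam_eig : eigenvalue (invmx (prec Ah B Sh C Xh) *m saddle A B C E) lam)
  (lam_notin : lam \notin itvA Ah A) :
  (E = 0 ->
    exists gA gR gK : R,
      [/\ gA \in itvA Ah A, gR \in itvR Ah B Sh, gK \in itvK Sh C Xh &
          pi_pol lam gA gR gK = 0]) /\
  (E != 0 ->
    exists gA gR gK gE gX : R,
      [/\ gA \in itvA Ah A, gR \in itvR Ah B Sh & gK \in itvK Sh C Xh] /\
      [/\ gE \in itvE E Xh, gX \in itvX Sh C E Xh, gX = gK + gE &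
          piE_pol lam gA gR gK gE = 0]).
Proof.
(* Empty sizes contradict [m_gt0] and [le_mn]; the results above are stated for successor sizes. *)
destruct m as [|m]; first by [].
destruct n as [|n]; first by [].
have [gA [gR [gK [gE [[gA_in gR_in gK_in gE_in gX_in] piE0]]]]] :=
  piE_root_exists (spd_sym A_spd) E_spsd B_full Ah_spd Sh_spd Xh_spd C_nonsing
    lam_notin minA_lt1 maxA_gt1 R_1 X_1 lam_eig.
split=> [E0|_]; last first.
  exists gA, gR, gK, gE, (gK + gE); split.
    exact: (And3 gA_in gR_in gK_in).
  exact: (And4 gE_in gX_in erefl piE0).
(* For [E = 0] the only eigenvalue of the pencil is 0, so its interval is a single point and
   [piE_pol] reduces to [pi_pol]. *)
have gE0 : gE = 0.
  have zero_eig a : eigenvalue (invmx Xh *m E) a -> a = 0.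
    case/eigenvalueP=> v /eqP; rewrite E0 mulmx0 mulmx0 eq_sym scaler_eq0.
    by move=> /orP[/eqP//|/eqP->]; rewrite eqxx.
  have [a a_eig] := pencil_eigenvalue_exists Xh_spd (spsd_sym E_spsd).
  have [/zero_eig min0 _] := eigminP a_eig.
  have [/zero_eig max0 _] := eigmaxP a_eig.
  by move: gE_in; rewrite in_itv /= min0 max0 -eq_le => /eqP.
exists gA, gR, gK; split; [exact: gA_in | exact: gR_in | exact: gK_in |].
by move: piE0; rewrite /piE_pol gE0 mul0r subr0.
Qed.
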